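(* Let $\{\delta_{n,m}\}_{m\in\mathcal I}\subset\mathbb R_{>0}$, $\mathfrak c\in[1,\infty)$, $\mathfrak h_0\in[1,\infty]$ and $c_7\in(0,1)$ be such that for every $m\in\mathcal I$, every $\alpha\ge c_7/2$ and every $1\le h\le\mathfrak h_0$, $$\sum_{m'\ge hm}e^{-\alpha n\delta_{n,m'}^2}\le 2e^{-\alpha nh\delta_{n,m}^2/\mathfrak c^2}.$$ Let $\lambda_n$ be the probability on $\mathcal I$ given by $\lambda_n(m)\propto\exp(-2n\delta_{n,m}^2)$. Then for every $\mathfrak h$ with $\mathfrak h_0\ge\mathfrak h\ge2\mathfrak c^2$ and every $m\in\mathcal I$, $$\lambda_n(m)\ge\tfrac12e^{-2n\delta_{n,m}^2},\qquad\sum_{k>\mathfrak hm}\lambda_n(k)\le2e^{-n\delta_{n,m}^2}.$$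
   Context: $\mathcal I=\mathbb N^q$ with $\mathbb N=\{1,2,\dots\}$ and the componentwise order: $a\le b$ iff $a_i\le b_i$ for all $1\le i\le q$, and similarly for $<,\ge,>$; $hm$ is the coordinatewise multiple. The sample size $n$ is fixed, and $\delta_{n,m}$ depends on $n,m$ only. ($\lambda_n$ serves as a prior on the index of a family of nested models $\{\mathcal F_m\}_{m\in\mathcal I}$, and $c_7\in(0,1)$ is a constant determined by the statistical experiment.) *)

(* Defs.v *)
From HB Require Import structures.
From mathcomp Require Import all_boot all_order all_algebra.
From mathcomp Require Import all_classical all_reals all_analysis.

Set Implicit Arguments.
Unset Strict Implicit.
Unset Printing Implicit Defensive.

Import Order.TTheory GRing.Theory Num.Theory.

Local Open Scope classical_set_scope.
Local Open Scope ring_scope.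

Definition posnat := {k : nat | (0 < k)%N}.

Definition multiindex (q : nat) := {ffun 'I_q -> posnat}.

Definition multiindex1 (q : nat) : multiindex q :=
  [ffun=> exist (fun k => (0 < k)%N) 1%N isT].

HB.instance Definition _ q := Countable.on (multiindex q).
HB.instance Definition _ q := isPointed.Build (multiindex q) (multiindex1 q).

HB.instance Definition _ q := @isMeasurable.Build default_measure_display
  (multiindex q) discrete_measurable discrete_measurable0
  discrete_measurableC discrete_measurableU.

Section ComponentwiseOrder.
Context {R : realType} {q : nat}.

(* Multi-indices are compared after embedding in R^q, because the factor h
   of a scaled multi-index h m is a real number. *)
Definition coords (m : multiindex q) : 'I_q -> R := fun i => (val (m i))%:R.

Definition scaled (h : R) (m : multiindex q) : 'I_q -> R :=
  fun i => h * coords m i.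

Definition cwle (a b : 'I_q -> R) : Prop := forall i, a i <= b i.

(* Strict in every coordinate: this is not "cwle a b and a <> b". *)
Definition cwlt (a b : 'I_q -> R) : Prop := forall i, a i < b i.

End ComponentwiseOrder.

Section Prior.
Context {R : realType} {q : nat}.
Variables (n : nat) (delta : nat -> multiindex q -> R).

Definition prior_weight (m : multiindex q) : R :=
  expR (- (2 * n%:R * delta n m ^+ 2)).

Definition weight_measure (A : set (multiindex q)) : \bar R :=
  (\esum_(m in A) (prior_weight m)%:E)%E.

Let weight_measure0 : weight_measure set0 = 0%E.
Proof. exact: esum_set0. Qed.

Let weight_measure_ge0 A : (0 <= weight_measure A)%E.
Proof. by apply: esum_ge0 => m _; rewrite lee_fin expR_ge0. Qed.

Let weight_measure_sigma_additive : semi_sigma_additive weight_measure.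
Proof.
move=> F mF tF mUF.
have -> : weight_measure (\bigcup_i F i) =
    (\sum_(0 <= i <oo) weight_measure (F i))%E.
  rewrite nneseries_esumT// /weight_measure esum_bigcupT// => m.
  by rewrite lee_fin expR_ge0.
by apply: is_cvg_nneseries => i _ _; exact: weight_measure_ge0.
Qed.

HB.instance Definition _ := isMeasure.Build _ _ _ weight_measure
  weight_measure0 weight_measure_ge0 weight_measure_sigma_additive.

(* The probability proportional to [prior_weight].  The Dirac mass is only the
   value [mnormalize] takes when the total weight is infinite. *)
Definition prior : probability (multiindex q) R :=
  mnormalize weight_measure (dirac (multiindex1 q)).

Lemma prior_set1 (m : multiindex q) : (weight_measure setT < +oo)%E ->
  prior [set m] = (prior_weight m / fine (weight_measure setT))%:E.
Proof.
move=> Zoo; have w0 k : (0 <= (prior_weight k)%:E)%E.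
  by rewrite lee_fin expR_ge0.
have wm : weight_measure [set m] = (prior_weight m)%:E.
  by rewrite /weight_measure (esum_set1 (a := fun k => (prior_weight k)%:E)).
have Z0 : weight_measure setT != 0%E.
  rewrite gt_eqF//; apply: (@lt_le_trans _ _ (weight_measure [set m])).
    by rewrite wm lte_fin expR_gt0.
  by apply: (@le_measure _ _ _ weight_measure); rewrite ?inE.
by rewrite /prior /= /mnormalize (negbTE Z0) (lt_eqF Zoo) /= wm EFinM.
Qed.

End Prior.

(* Main.v *)
Require Import Defs.
From mathcomp Require Import all_boot all_order all_algebra.
From mathcomp Require Import all_classical all_reals all_analysis.
From mathcomp Require Import ring lra.

(** The normalising constant [Z] of the prior is controlled from both sides.
    The componentwise smallest multi-index is (1, ..., 1), so the tail bound
    at that index, with [alpha = 2] and [h = 1], is a bound on the whole sum: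
    [Z <= 2] ([tail_multiindex1]).  Hence the prior is a genuine normalisation,
    and the probability of [m] is at least half its weight.

    For the tail, [Z] may be very small, but it is at least the weight
    [expR (- 2 n delta_m^2)] of the single index [m]; normalising thus costs a
    factor at most [expR (2 n delta_m^2)].  On the other hand the tail bound
    with [alpha = 2] and [h >= 2 c^2] bounds the unnormalised tail beyond
    [h m] by [2 expR (- 4 n delta_m^2)]; this absorbs that factor and leaves
    [2 expR (- 2 n delta_m^2)], which is at most the claimed bound. *)

Set Implicit Arguments.
Unset Strict Implicit.
Unset Printing Implicit Defensive.

Import Order.TTheory GRing.Theory Num.Theory.

Local Open Scope classical_set_scope.
Local Open Scope ring_scope.

(** The finite partial sums are homogeneous, and [r] times each of them is below
    [r] times their supremum. *)
Lemma ge0_esumZl_le (R : realType) (T : choiceType) (I : set T) (r : \bar R)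
    (a : T -> \bar R) : (0 <= r)%E -> (forall i, (0 <= a i)%E) ->
  (\esum_(i in I) (r * a i) <= r * \esum_(i in I) a i)%E.
Proof.
move=> r0 a0; apply: ge_ereal_sup => _ [X XI <-].
rewrite -ge0_mule_fsumr// lee_wpmul2l//.
by apply: ereal_sup_ubound; exists X.
Qed.

Lemma cwle_multiindex1 (R : realType) (q : nat) (m : multiindex q) :
  cwle (scaled 1 (multiindex1 q)) (coords m : 'I_q -> R).
Proof.
by move=> i; rewrite /scaled /coords mul1r ffunE ler_nat; exact: valP (m i).
Qed.

Lemma cwltW (R : realType) (q : nat) (a b : 'I_q -> R) : cwlt a b -> cwle a b.
Proof. by move=> ab i; exact: ltW. Qed.

Section PriorBounds.
Context (R : realType) (q n : nat) (delta : nat -> multiindex q -> R).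

Local Notation w := (prior_weight n delta).
Local Notation Z := (weight_measure n delta setT).

Lemma prior_weight_ge0 m : (0 <= (w m)%:E)%E.
Proof. by rewrite lee_fin expR_ge0. Qed.

Lemma prior_weight_le_total m : ((w m)%:E <= Z)%E.
Proof.
rewrite -[X in (X <= _)%E](@esum_set1 _ _ m (fun k => (w k)%:E)).
  by apply: (@le_measure _ _ _ (weight_measure n delta)); rewrite ?inE.
exact: prior_weight_ge0.
Qed.

Lemma fin_total_weight : (Z < +oo)%E -> (fine Z)%:E = Z.
Proof. by move=> Zoo; rewrite fineK// ge0_fin_numE. Qed.

Lemma prior_set1_ge (C : R) m : (Z <= C%:E)%E ->
  ((C^-1 * w m)%:E <= prior n delta [set m])%E.
Proof.
move=> ZC; have Zoo : (Z < +oo)%E by exact: le_lt_trans ZC (ltry _).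
have Z0 : 0 < fine Z.
  rewrite -lte_fin fin_total_weight//.
  by apply: lt_le_trans (prior_weight_le_total m); rewrite lte_fin expR_gt0.
rewrite prior_set1// lee_fin mulrC ler_wpM2l ?expR_ge0//.
have ZC' : fine Z <= C by rewrite -lee_fin fin_total_weight.
by rewrite lef_pV2// posrE (lt_le_trans Z0).
Qed.

(** The reference index [m] stands in for the unknown total weight, which is
    at least the weight of [m]. *)
Lemma prior_esum_le (A : set (multiindex q)) m : (Z < +oo)%E ->
  (\esum_(k in A) prior n delta [set k] <=
   ((w m)^-1)%:E * \esum_(k in A) (w k)%:E)%E.
Proof.
move=> Zoo; have wm0 : 0 < w m by exact: expR_gt0.
apply: le_trans (ge0_esumZl_le A _ prior_weight_ge0); last first.
  by rewrite lee_fin invr_ge0 ltW.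
apply: le_esum => k _.
rewrite prior_set1// -EFinM lee_fin mulrC ler_wpM2r ?expR_ge0//.
have wZ : w m <= fine Z.
  by rewrite -lee_fin fin_total_weight//; exact: prior_weight_le_total.
by rewrite lef_pV2// posrE (lt_le_trans wm0).
Qed.

Lemma tail_multiindex1 :
  (\esum_(k in [set k | cwle (scaled (1 : R) (multiindex1 q)) (coords k)])
      (w k)%:E)%E = Z.
Proof.
congr (weight_measure n delta _).
by apply/seteqP; split => // k _; exact: cwle_multiindex1.
Qed.

End PriorBounds.

Theorem proposition2p2 (R : realType) (q n : nat) (hq : (0 < q)%N)
  (hn : (0 < n)%N)
  (delta : nat -> multiindex q -> R) (hdelta : forall m, 0 < delta n m)
  (c : R) (hc : 1 <= c)
  (h0 : \bar R) (hh0 : (1 <= h0)%E)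
  (c7 : R) (hc7 : 0 < c7 < 1)
  (hsum : forall (m : multiindex q) (alpha h : R),
    c7 / 2 <= alpha -> 1 <= h -> (h%:E <= h0)%E ->
    (\esum_(m' in [set m' | cwle (scaled h m) (coords m')])
        (expR (- (alpha * n%:R * delta n m' ^+ 2)))%:E
     <= (2 * expR (- (alpha * n%:R * h * delta n m ^+ 2 / c ^+ 2)))%:E)%E) :
  forall (h : R) (m : multiindex q), 2 * c ^+ 2 <= h -> (h%:E <= h0)%E ->
    ((2^-1 * expR (- (2 * n%:R * delta n m ^+ 2)))%:E
       <= prior n delta [set m])%E /\
    (\esum_(k in [set k | cwlt (scaled h m) (coords k)]) prior n delta [set k]
       <= (2 * expR (- (n%:R * delta n m ^+ 2)))%:E)%E.
Proof.
move=> h m hle hh.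
have c2 : 1 <= c ^+ 2 by rewrite exprn_ege1.
have h1 : 1 <= h by apply: le_trans hle; rewrite mulr_ege1// ler1n.
have a2 : c7 / 2 <= 2 by case/andP: hc7 => _ c71; lra.
have Z2 : (weight_measure n delta setT <= 2%:E)%E.
  rewrite -tail_multiindex1.
  apply: le_trans (hsum (multiindex1 q) 2 1 a2 (lexx 1) hh0) _.
  rewrite lee_fin ler_piMr// expR_le1 oppr_le0.
  by rewrite mulr1 divr_ge0 ?sqr_ge0// mulr_ge0 ?sqr_ge0// mulr_ge0.
split; first exact: prior_set1_ge.
have Zoo : (weight_measure n delta setT < +oo)%E.
  by exact: le_lt_trans Z2 (ltry _).
apply: le_trans (prior_esum_le _ m Zoo) _.
set S := (X in (_ * X)%E).
have tail : (S <= (2 * expR (- (2 * n%:R * h * delta n m ^+ 2 / c ^+ 2)))%:E)%E.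
  apply: le_trans _ (hsum m 2 h a2 h1 hh).
  apply: (@le_measure _ _ _ (weight_measure n delta)); rewrite ?inE//.
  by move=> k; exact: cwltW.
apply: (le_trans (lee_wpmul2l _ tail)); first by rewrite lee_fin invr_ge0 expR_ge0.
rewrite -EFinM lee_fin /prior_weight -expRN opprK mulrCA -expRD ler_wpM2l//.
rewrite ler_expR.
(* Since h / c ^+ 2 >= 2, the tail has exponent at most -4 n delta_m^2; the
   normalisation returns 2 n delta_m^2 of it. *)
have d0 : 0 <= n%:R * delta n m ^+ 2 by rewrite mulr_ge0// sqr_ge0.
have hc2 : 2 <= h / c ^+ 2 by rewrite ler_pdivlMr// (lt_le_trans ltr01).
rewrite (_ : 2 * n%:R * h * _ / _ = 2 * (h / c ^+ 2) * (n%:R * delta n m ^+ 2));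
  last by ring.
nra.
Qed.
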